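(* Let $\mathcal H$ be a Hilbert space, let $H_0$ be a self-adjoint operator in $\mathcal H$ with domain $\mathcal D$, bounded below, and let $H_1$ be a bounded (continuous) operator on $\mathcal H$, $H_1\neq 0$. Assume there is a unitary involution $J$ on $\mathcal H$ with $J\mathcal D\subset\mathcal D$, $JH_0=H_0J$ and $JH_1=H_1^*J$. Suppose $H_0$ has discrete spectrum $\sigma(H_0)=\{\lambda_0<\lambda_1<\dots<\lambda_l<\dots\}$, all eigenvalues simple, with $$\delta:=\inf_{j\ge0}\,\frac{\lambda_{j+1}-\lambda_j}{2}>0.$$ For $\epsilon\in\mathbb C$ let $H_\epsilon=H_0+\epsilon H_1$ with domain $\mathcal D$. Then $\sigma(H_\epsilon)\subset\mathbb R$ for every real $\epsilon$ with $|\epsilon|<\delta/\|H_1\|$.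
   Context: $H_1^*$ denotes the adjoint of $H_1$. The intertwining relations imply $JH_\epsilon=H_\epsilon^*J$ for real $\epsilon$. *)

(* Defs.v *)
From HB Require Import structures.
From mathcomp Require Import all_boot all_order all_algebra.
From mathcomp Require Import classical_sets reals.
From mathcomp Require Import complex.
Set Implicit Arguments. Unset Strict Implicit. Unset Printing Implicit Defensive.
Import Order.TTheory GRing.Theory Num.Theory.
Local Open Scope ring_scope.
Local Open Scope classical_set_scope.

Section Hilbert.
Variables (R : realType) (V : lmodType R[i]).

Definition is_inner_product (ip : V -> V -> R[i]) : Prop :=
  [/\ (forall a x y z, ip (a *: x + y) z = a * ip x z + ip y z),
      (forall x y, ip y x = conjc (ip x y)),
      (forall x, 0 <= complex.Re (ip x x) /\ complex.Im (ip x x) = 0) &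
      (forall x, ip x x = 0 -> x = 0)].

Definition hnorm (ip : V -> V -> R[i]) (x : V) : R := Num.sqrt (complex.Re (ip x x)).

Definition hcomplete (ip : V -> V -> R[i]) : Prop :=
  forall u : nat -> V,
    (forall e : R, 0 < e -> exists N, forall m n, (N <= m)%N -> (N <= n)%N ->
        hnorm ip (u m - u n) < e) ->
    exists l, forall e : R, 0 < e -> exists N, forall n, (N <= n)%N ->
        hnorm ip (u n - l) < e.

Definition subspace (D : V -> Prop) : Prop :=
  D 0 /\ forall a x y, D x -> D y -> D (a *: x + y).

Definition dense (ip : V -> V -> R[i]) (D : V -> Prop) : Prop :=
  forall x (e : R), 0 < e -> exists d, D d /\ hnorm ip (x - d) < e.

(* T is linear on the subspace D (values outside D are irrelevant) *)
Definition linear_on (D : V -> Prop) (T : V -> V) : Prop :=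
  forall a x y, D x -> D y -> T (a *: x + y) = a *: T x + T y.

(* (possibly unbounded) self-adjoint operator with domain D:
   D dense subspace, T linear on D, Dom(T^* ) = D and T^* = T on D. *)
Definition self_adjoint (ip : V -> V -> R[i]) (D : V -> Prop) (T : V -> V) : Prop :=
  [/\ subspace D, dense ip D, linear_on D T,
      (forall y, D y <-> exists z, forall x, D x -> ip (T x) y = ip x z) &
      (forall x y, D x -> D y -> ip (T x) y = ip x (T y))].

Definition bounded_below (ip : V -> V -> R[i]) (D : V -> Prop) (T : V -> V) : Prop :=
  exists c : R, forall x, D x -> c * hnorm ip x ^+ 2 <= complex.Re (ip (T x) x).

Definition bounded_op (ip : V -> V -> R[i]) (A : V -> V) : Prop :=
  linear_on setT A /\ exists M : R, forall x, hnorm ip (A x) <= M * hnorm ip x.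

Definition opnorm (ip : V -> V -> R[i]) (A : V -> V) : R :=
  sup [set hnorm ip (A x) | x in [set x | hnorm ip x <= 1]].

Definition is_adjoint (ip : V -> V -> R[i]) (A B : V -> V) : Prop :=
  forall x y, ip (A x) y = ip x (B y).

Definition unitary_involution (ip : V -> V -> R[i]) (J : V -> V) : Prop :=
  [/\ linear_on setT J, (forall x y, ip (J x) (J y) = ip x y) & (forall x, J (J x) = x)].

(* resolvent set of an operator T with domain D: T - z maps D bijectively onto V
   with bounded inverse (the bound also gives injectivity) *)
Definition resolvent (ip : V -> V -> R[i]) (D : V -> Prop) (T : V -> V) (z : R[i]) : Prop :=
  (forall y, exists x, D x /\ T x - z *: x = y) /\
  exists M : R, forall x, D x -> hnorm ip x <= M * hnorm ip (T x - z *: x).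

Definition spectrum (ip : V -> V -> R[i]) (D : V -> Prop) (T : V -> V) : set R[i] :=
  [set z | ~ resolvent ip D T z].

Definition simple_eigenvalue (D : V -> Prop) (T : V -> V) (z : R[i]) : Prop :=
  exists v, [/\ D v, v <> 0, T v = z *: v &
    forall w, D w -> T w = z *: w -> exists a, w = a *: v].

End Hilbert.

(* Main.v *)
(* No contour integral or perturbation series is used.  For nonreal [z] the
   operator [H0 + s H1 - z] is shown to be bounded below, uniformly for
   [|s| <= |eps|]; surjectivity then propagates from [s = 0] to [s = eps] in
   small steps.

   For the lower bound, suppose [(H0 + s H1 - z) u] is small.  Since [H0 + s H1]
   is symmetric for the indefinite form [ip x (J y)], the number [ip u (J u)] is
   small.  On the other hand [|(H0 - Re z) u| < delta |u|] up to a small error,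
   and the spectrum of [H0] has gaps at least [2 delta]: so [Re z] lies within
   [delta] of some eigenvalue, and more than half of the squared norm of [u] is
   carried by its eigenvector.  The eigenvalue being simple, [J] acts on that
   eigenvector as [1] or [-1], so [ip u (J u)] is not small: a contradiction. *)

Require Import Defs.
From HB Require Import structures.
From mathcomp Require Import all_boot all_order all_algebra.
From mathcomp Require Import classical_sets reals.
From mathcomp Require Import complex.
From mathcomp Require Import boolp ring lra.
Import Order.TTheory GRing.Theory Num.Theory.
Local Open Scope ring_scope.
Local Open Scope classical_set_scope.

Section RealPart.
Context {R : realType} {V : lmodType R[i]} {ip : V -> V -> R[i]}.
Hypothesis Hip : is_inner_product ip.
Implicit Types (x y z : V) (r a b : R).

Definition rip x y : R := complex.Re (ip x y).

Lemma ipDl x y z : ip (x + y) z = ip x z + ip y z.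
Proof. by case: Hip => L _ _ _; have := L 1 x y z; rewrite scale1r mul1r. Qed.

Lemma ip0l z : ip 0 z = 0.
Proof. by apply: (addrI (ip 0 z)); rewrite -ipDl !addr0. Qed.

Lemma ipZl (c : R[i]) x z : ip (c *: x) z = c * ip x z.
Proof. by case: Hip => L _ _ _; have := L c x 0 z; rewrite ip0l !addr0. Qed.

Lemma ipC x y : ip y x = conjc (ip x y).
Proof. by case: Hip. Qed.

Lemma ip_sym_eq0 x y : ip x y = 0 -> ip y x = 0.
Proof. by move=> h; rewrite ipC h conjc0. Qed.

Lemma ipZr (c : R[i]) x z : ip z (c *: x) = conjc c * ip z x.
Proof. by rewrite ipC [ip z x]ipC ipZl rmorphM. Qed.

Lemma ipDr x y z : ip z (x + y) = ip z x + ip z y.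
Proof. by rewrite ipC [ip z x]ipC [ip z y]ipC ipDl rmorphD. Qed.

Lemma ipNl x y : ip (- x) y = - ip x y.
Proof. by rewrite -scaleN1r ipZl mulN1r. Qed.

Lemma ipNr x y : ip x (- y) = - ip x y.
Proof. by rewrite ipC [ip x y]ipC ipNl rmorphN. Qed.

Lemma ip_normE x : ip x x = (rip x x)%:C%C.
Proof.
case: Hip => _ _ /(_ x) [_ h] _; rewrite /rip.
by case: (ip x x) h => a b /= ->.
Qed.

Lemma ripC x y : rip x y = rip y x.
Proof. by rewrite /rip ipC; case: (ip _ _). Qed.

Lemma ripDl x y z : rip (x + y) z = rip x z + rip y z.
Proof. by rewrite /rip ipDl; case: (ip x z) => ? ?; case: (ip y z). Qed.

Lemma ripDr x y z : rip z (x + y) = rip z x + rip z y.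
Proof. by rewrite ripC ripDl !(ripC z). Qed.

Lemma ripNl x y : rip (- x) y = - rip x y.
Proof. by rewrite /rip ipNl; case: (ip x y). Qed.

Lemma ripNr x y : rip x (- y) = - rip x y.
Proof. by rewrite ripC ripNl ripC. Qed.

Lemma ripZl r x y : rip (r%:C%C *: x) y = r * rip x y.
Proof. by rewrite /rip ipZl; case: (ip x y) => ? ? /=; rewrite mul0r subr0. Qed.

Lemma ripZr r x y : rip x (r%:C%C *: y) = r * rip x y.
Proof. by rewrite ripC ripZl ripC. Qed.

Definition ripE := (ripDl, ripDr, ripNl, ripNr, ripZl, ripZr).

Lemma rip_ge0 x : 0 <= rip x x.
Proof. by case: Hip => _ _ /(_ x) []. Qed.

Lemma rip_eq0 x : rip x x = 0 -> x = 0.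
Proof. by move=> h; case: Hip => _ _ _; apply; rewrite ip_normE h. Qed.

Lemma rip_pythagoras x y :
  rip x y = 0 -> rip (x + y) (x + y) = rip x x + rip y y.
Proof. by move=> h; rewrite !ripE (ripC y x) h addr0 add0r. Qed.

Lemma hnorm_sq x : hnorm ip x ^+ 2 = rip x x.
Proof. by rewrite sqr_sqrtr ?rip_ge0. Qed.

Lemma hnorm_ge0 x : 0 <= hnorm ip x.
Proof. exact: sqrtr_ge0. Qed.

Lemma hnorm_eq0 x : hnorm ip x = 0 -> x = 0.
Proof. by move=> h; apply: rip_eq0; rewrite -hnorm_sq h expr0n. Qed.

Lemma hnorm0 : hnorm ip 0 = 0.
Proof. by rewrite /hnorm ip0l sqrtr0. Qed.

Lemma ler_hnorm a x : rip x x <= a ^+ 2 -> 0 <= a -> hnorm ip x <= a.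
Proof.
by move=> h a0; rewrite -(@ler_pXn2r _ 2) ?nnegrE ?hnorm_ge0 // hnorm_sq.
Qed.

Lemma hnormZ r x : hnorm ip (r%:C%C *: x) = `|r| * hnorm ip x.
Proof.
apply/eqP; rewrite -(@eqrXn2 _ 2) ?mulr_ge0 ?hnorm_ge0 //.
by rewrite hnorm_sq exprMn hnorm_sq real_normK ?num_real // !ripE mulrA.
Qed.

Lemma hnormN x : hnorm ip (- x) = hnorm ip x.
Proof. by rewrite /hnorm ipNl ipNr opprK. Qed.

Lemma hnormBC x y : hnorm ip (x - y) = hnorm ip (y - x).
Proof. by rewrite -opprB hnormN. Qed.

Lemma rip_cauchy_schwarz x y : rip x y <= hnorm ip x * hnorm ip y.
Proof.
have [/hnorm_eq0->|x0] := eqVneq (hnorm ip x) 0.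
  by rewrite /rip ip0l hnorm0 mul0r.
have [/hnorm_eq0->|y0] := eqVneq (hnorm ip y) 0.
  by rewrite ripC /rip ip0l hnorm0 mulr0.
have xp : 0 < hnorm ip x by rewrite lt_neqAle eq_sym x0 hnorm_ge0.
have yp : 0 < hnorm ip y by rewrite lt_neqAle eq_sym y0 hnorm_ge0.
have := rip_ge0 ((hnorm ip y)%:C%C *: x - (hnorm ip x)%:C%C *: y).
rewrite !ripE -!hnorm_sq (ripC y x) => h.
rewrite -(ler_pM2l (mulr_gt0 xp yp)).
nra.
Qed.

Lemma hnormD x y : hnorm ip (x + y) <= hnorm ip x + hnorm ip y.
Proof.
apply: ler_hnorm; last by rewrite addr_ge0 ?hnorm_ge0.
rewrite !ripE (ripC y x) -!hnorm_sq.
have := rip_cauchy_schwarz x y; lra.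
Qed.

Lemma hnormB x y : hnorm ip (x - y) <= hnorm ip x + hnorm ip y.
Proof. by rewrite -(hnormN y) hnormD. Qed.

Lemma hnormB_ge x y : hnorm ip x - hnorm ip y <= hnorm ip (x - y).
Proof. by rewrite lerBlDr -{1}(subrK y x) hnormD. Qed.

Lemma Im_cauchy_schwarz x y :
  `|complex.Im (ip x y)| <= hnorm ip x * hnorm ip y.
Proof.
have ImE z : complex.Im (ip x z) = - rip ('i%C *: x) z.
  by rewrite /rip ipZl; case: (ip x z) => ? ? /=; ring.
have niE : hnorm ip ('i%C *: x) = hnorm ip x.
  by rewrite /hnorm ipZl ipZr; case: (ip x x) => u v /=; congr Num.sqrt; ring.
rewrite ler_norml ImE lerN2 -ripNl -niE rip_cauchy_schwarz /=.
by rewrite -(hnormN ('i%C *: x)) rip_cauchy_schwarz.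
Qed.

Definition invS (C : R) (n : nat) : R := C / n.+1%:R.

Lemma le0_invS a (C : R) : 0 <= C -> (forall n, a <= invS C n) -> a <= 0.
Proof.
move=> C0 h; rewrite leNgt; apply/negP => a0.
have ca : 0 <= C / a by rewrite divr_ge0 // ltW.
have := archi_boundP ca; set n := Num.bound _ => hn.
have := h n; rewrite /invS ler_pdivlMr ?ltr0Sn // leNgt => /negP; apply.
move: hn; rewrite ltr_pdivrMr // => hn.
by apply: lt_le_trans hn _; rewrite mulrC ler_pM2l // ler_nat.
Qed.

Lemma invS_lt (C e : R) : 0 <= C -> 0 < e -> exists n, invS C n < e.
Proof.
move=> C0 e0; have ce : 0 <= C / e by rewrite divr_ge0 // ltW.
exists (Num.bound (C / e)); rewrite /invS.
rewrite ltr_pdivrMr ?ltr0Sn // mulrC -ltr_pdivrMr //.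
by apply: lt_trans (archi_boundP ce) _; rewrite ltr_nat.
Qed.

Lemma invS_anti (C : R) m n : 0 <= C -> (n <= m)%N -> invS C m <= invS C n.
Proof.
by move=> C0 nm; rewrite /invS ler_wpM2l // lef_pV2 ?posrE ?ltr0Sn // ler_nat.
Qed.

Lemma invS_ge0 (C : R) n : 0 <= C -> 0 <= invS C n.
Proof. by move=> C0; rewrite divr_ge0. Qed.

Lemma hcomplete_rate (u : nat -> V) (C : R) :
  hcomplete ip -> 0 <= C ->
  (forall n m, (n <= m)%N -> hnorm ip (u m - u n) <= invS C n) ->
  exists l, forall n, hnorm ip (u n - l) <= invS C n.
Proof.
move=> cpl C0 hu.
have [e e0|l hl] := cpl u.
  have [N hN] := invS_lt C (e / 2) C0 (divr_gt0 e0 (ltr0Sn _ _)).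
  exists N => m n Nm Nn.
  have -> : u m - u n = (u m - u N) - (u n - u N) by rewrite opprB addrA subrK.
  have := hnormB (u m - u N) (u n - u N).
  have := hu _ _ Nm; have := hu _ _ Nn; lra.
exists l => n; apply/ler_addgt0Pr => e e0.
have [N hN] := hl e e0.
have := hN (maxn N n) (leq_maxl _ _).
have := hu n (maxn N n) (leq_maxr _ _).
have := hnormB (u (maxn N n) - l) (u (maxn N n) - u n).
rewrite opprB addrC addrA subrK; lra.
Qed.

End RealPart.

Arguments rip {R V} ip x y.

Section LinearOn.
Context {R : realType} {V : lmodType R[i]} {D : V -> Prop} {T : V -> V}.
Hypotheses (sD : subspace D) (lT : linear_on D T).
Implicit Types x y : V.

Lemma subspaceD {x y} : D x -> D y -> D (x + y).
Proof. by move=> dx dy; have := sD.2 1 x y dx dy; rewrite scale1r. Qed.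

Lemma subspaceZ c {x} : D x -> D (c *: x).
Proof. by move=> dx; have := sD.2 c x 0 dx sD.1; rewrite addr0. Qed.

Lemma subspaceN {x} : D x -> D (- x).
Proof. by rewrite -scaleN1r; apply: subspaceZ. Qed.

Lemma subspaceB {x y} : D x -> D y -> D (x - y).
Proof. by move=> dx dy; apply: subspaceD => //; apply: subspaceN. Qed.

Lemma linear_onD {x y} : D x -> D y -> T (x + y) = T x + T y.
Proof. by move=> dx dy; have := lT 1 x y dx dy; rewrite !scale1r. Qed.

Lemma linear_on0 : T 0 = 0.
Proof.
apply: (addrI (T 0)); rewrite -linear_onD ?addr0 //; exact: sD.1.
Qed.

Lemma linear_onZ c {x} : D x -> T (c *: x) = c *: T x.
Proof. by move=> dx; have := lT c x 0 dx sD.1; rewrite linear_on0 !addr0. Qed.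

Lemma linear_onN {x} : D x -> T (- x) = - T x.
Proof. by move=> dx; rewrite -scaleN1r linear_onZ // scaleN1r. Qed.

Lemma linear_onB {x y} : D x -> D y -> T (x - y) = T x - T y.
Proof.
by move=> dx dy; rewrite linear_onD ?linear_onN //; apply: subspaceN.
Qed.

End LinearOn.

Definition shift {R : realType} {V : lmodType R[i]} (T : V -> V) (c : R)
  (x : V) : V := T x - c%:C%C *: x.

Definition symmetric_on {R : realType} {V : lmodType R[i]}
  (ip : V -> V -> R[i]) (D : V -> Prop) (T : V -> V) : Prop :=
  forall x y, D x -> D y -> rip ip (T x) y = rip ip x (T y).

Definition surj_on {R : realType} {V : lmodType R[i]} (D : V -> Prop)
  (T : V -> V) : Prop := forall y, exists x, D x /\ T x = y.

Definition coercive_on {R : realType} {V : lmodType R[i]}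
  (ip : V -> V -> R[i]) (D : V -> Prop) (k : R) (T : V -> V) : Prop :=
  forall x, D x -> k * hnorm ip x <= hnorm ip (T x).

Section Shift.
Context {R : realType} {V : lmodType R[i]} {ip : V -> V -> R[i]}.
Context {D : V -> Prop} {T : V -> V}.
Hypotheses (Hip : is_inner_product ip) (sD : subspace D).

Lemma shift_shift a b x : shift (shift T a) b x = shift T (a + b) x.
Proof.
by rewrite /shift (rmorphD (real_complex _)) scalerDl opprD addrA.
Qed.

Lemma shift_linear_on c : linear_on D T -> linear_on D (shift T c).
Proof.
move=> lT a x y dx dy; rewrite /shift lT // scalerBr scalerDr opprD addrACA.
by congr (_ - _ + _); rewrite !scalerA mulrC.
Qed.

Lemma shift_symmetric_on c : symmetric_on ip D T -> symmetric_on ip D (shift T c).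
Proof. by move=> sT x y dx dy; rewrite /shift !(ripE Hip) sT. Qed.

End Shift.

Section Gap.
Context {R : realType} {V : lmodType R[i]} {ip : V -> V -> R[i]}.
Context {D : V -> Prop} {T : V -> V}.
Hypotheses (Hip : is_inner_product ip) (sD : subspace D).
Hypotheses (lT : linear_on D T) (sT : symmetric_on ip D T).
Implicit Types (x y p q : V) (m k r g h : R).

Lemma coercive_improve m k : 0 <= m -> 0 < k ->
  surj_on D T -> coercive_on ip D m T ->
  coercive_on ip D k (shift T m) -> coercive_on ip D k (shift T (- m)) ->
  exists m', m < m' /\ coercive_on ip D m' T.
Proof.
move=> m0 k0 sur cm ck1 ck2.
pose kk := k ^+ 2 / (k + m).
have km : 0 < k + m by lra.
have kk0 : 0 < kk by rewrite divr_gt0 // exprn_gt0.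
exists (Num.sqrt (m ^+ 2 + kk ^+ 2)); split.
  rewrite -{1}(ger0_norm m0) -sqrtr_sqr ltr_sqrt ?ltrDl ?exprn_gt0 //.
  by rewrite ltr_wpDl ?exprn_gt0 ?sqr_ge0.
move=> q dq; have [p [dp Tpq]] := sur q.
have mp0 : D (m%:C%C *: p) by apply: subspaceZ.
have dqm : D (q + m%:C%C *: p) by apply: subspaceD.
(* [T q - m^2 p = (T - m) (T + m) p] bounded from both sides *)
have E : shift T m (q + m%:C%C *: p) = T q - (m ^+ 2)%:C%C *: p.
  rewrite /shift (linear_onD lT) // (linear_onZ sD lT) // Tpq scalerDr.
  by rewrite scalerA -rmorphM opprD addrA addrK -expr2.
have up : hnorm ip (T q - (m ^+ 2)%:C%C *: p) ^+ 2 <=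
    hnorm ip (T q) ^+ 2 - m ^+ 2 * hnorm ip q ^+ 2.
  have := cm p dp; rewrite Tpq => h.
  have : (m * hnorm ip p) ^+ 2 <= hnorm ip q ^+ 2.
    by rewrite ler_pXn2r ?nnegrE ?mulr_ge0 ?hnorm_ge0.
  rewrite exprMn !(hnorm_sq Hip) !(ripE Hip) (ripC Hip p (T q)) (sT q p) // Tpq => h2.
  have : m ^+ 2 * (m ^+ 2 * rip ip p p) <= m ^+ 2 * rip ip q q.
    by rewrite ler_wpM2l ?sqr_ge0.
  lra.
have low : kk * hnorm ip q <= hnorm ip (T q - (m ^+ 2)%:C%C *: p).
  rewrite -E; apply: le_trans (ck1 _ dqm).
  have := ck2 p dp; rewrite /shift Tpq (rmorphN (real_complex _)) scaleNr opprK.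
  have := hnormB_ge Hip q (- (m%:C%C *: p)).
  rewrite opprK (hnormN Hip) (hnormZ Hip) ger0_norm // => h1 h2.
  have h3 : k * hnorm ip q <= (k + m) * hnorm ip (q + m%:C%C *: p) by nra.
  have : k * (k * hnorm ip q) <= k * ((k + m) * hnorm ip (q + m%:C%C *: p)).
    by rewrite ler_pM2l.
  rewrite /kk mulrAC ler_pdivrMr // expr2 -!mulrA; lra.
have kq : 0 <= kk * hnorm ip q by rewrite mulr_ge0 ?hnorm_ge0 // ltW.
have {}low : (kk * hnorm ip q) ^+ 2 <= hnorm ip (T q - (m ^+ 2)%:C%C *: p) ^+ 2.
  by rewrite ler_pXn2r ?nnegrE ?hnorm_ge0.
rewrite -(@ler_pXn2r _ 2) ?nnegrE ?mulr_ge0 ?hnorm_ge0 ?sqrtr_ge0 //.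
rewrite exprMn sqr_sqrtr ?addr_ge0 ?sqr_ge0 //.
move: low; rewrite exprMn; lra.
Qed.

(* A symmetric operator whose resolvent set contains ]-r, r[ is bounded below
   by [r]: otherwise the best bound [m < r] could be improved, as [m] and [-m]
   are still in the resolvent set. *)
Lemma gap_coercive r : 0 <= r -> surj_on D T ->
  (forall w, `|w| < r -> exists2 k, 0 < k & coercive_on ip D k (shift T w)) ->
  coercive_on ip D r T.
Proof.
move=> r0 sur ck.
pose E := [set m | [/\ 0 <= m, m <= r & coercive_on ip D m T]].
have E0 : E 0 by split=> // x _; rewrite mul0r hnorm_ge0.
have hE : has_sup E by split; [exists 0 | exists r => m []].
have ubE := sup_upper_bound hE.
set M := sup E in ubE.
have M0 : 0 <= M by apply: ubE.
have Mr : M <= r by apply: sup_le_ub; [exists 0 | move=> m []].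
have cM : coercive_on ip D M T.
  move=> x dx; have [/eqP h|h] := eqVneq (hnorm ip x) 0.
    by rewrite (eqP h) mulr0 hnorm_ge0.
  have xp : 0 < hnorm ip x by rewrite lt_neqAle eq_sym h hnorm_ge0.
  rewrite -ler_pdivlMr //; apply: sup_le_ub; first by exists 0.
  by move=> m [_ _ cm]; rewrite ler_pdivlMr //; apply: cm.
have [rM|Mlt] := leP r M; first by have -> : r = M by lra.
have Mn : `|M| < r by rewrite ger0_norm.
have [k1 k10 c1] := ck M Mn.
have [k2 k20 c2] : exists2 k, 0 < k & coercive_on ip D k (shift T (- M)).
  by apply: ck; rewrite normrN.
have [m' [Mm' cm']] := coercive_improve M (Num.min k1 k2) M0
  (ltac:(by rewrite lt_min k10 k20)) sur cM
  (ltac:(move=> x dx; apply: le_trans (c1 x dx); rewrite ler_wpM2r ?hnorm_ge0 ?ge_min ?lexx //))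
  (ltac:(move=> x dx; apply: le_trans (c2 x dx); rewrite ler_wpM2r ?hnorm_ge0 ?ge_min ?lexx ?orbT //)).
have : E (Num.min m' r).
  split; [by rewrite le_min r0 andbT; lra | by rewrite ge_min lexx orbT |].
  move=> x dx; apply: le_trans (cm' x dx).
  by rewrite ler_wpM2r ?hnorm_ge0 // ge_min lexx.
by move/ubE; rewrite leNgt lt_min Mm' Mlt.
Qed.

(* The hypotheses say [T (T - g) >= 0] and [T (T + g) >= 0]; evaluating these
   forms at [(T + g) p] and [(T - g) p] and adding gives [T^4 >= g^2 T^2]. *)
Lemma coercive_on_range g p : 0 < g ->
  coercive_on ip D (g / 2) (shift T (g / 2)) ->
  coercive_on ip D (g / 2) (shift T (- (g / 2))) ->
  D p -> D (T p) -> g * hnorm ip (T p) <= hnorm ip (T (T p)).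
Proof.
move=> g0 c1 c2 dp dTp.
have form s q : D q -> coercive_on ip D (g / 2) (shift T (s * (g / 2))) ->
    s ^+ 2 = 1 -> 0 <= rip ip (T q) (T q) - s * g * rip ip (T q) q.
  move=> dq /(_ q dq) h s1.
  have {}h : (g / 2 * hnorm ip q) ^+ 2 <= hnorm ip (shift T (s * (g / 2)) q) ^+ 2.
    by rewrite ler_pXn2r ?nnegrE ?mulr_ge0 ?invr_ge0 ?hnorm_ge0 ?(ltW g0).
  move: h; rewrite exprMn !(hnorm_sq Hip).
  rewrite /shift !(ripE Hip) (ripC Hip q (T q)).
  have : s ^+ 2 * ((g / 2) ^+ 2 * rip ip q q) = (g / 2) ^+ 2 * rip ip q q.
    by rewrite s1 mul1r.
  lra.
have gp : D (g%:C%C *: p) by apply: subspaceZ.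
have d1 : D (T p + g%:C%C *: p) by apply: subspaceD.
have d2 : D (T p - g%:C%C *: p) by apply: subspaceB.
have := form 1 _ d1; rewrite mul1r expr1n => /(_ c1 erefl).
have := form (- 1) _ d2; rewrite mulN1r sqrrN expr1n => /(_ c2 erefl).
rewrite (linear_onB sD lT) // (linear_onD lT) // (linear_onZ sD lT) //.
rewrite !(ripE Hip) (ripC Hip (T p) (T (T p))) (sT (T p) p) // => h1 h2.
rewrite -(@ler_pXn2r _ 2) ?nnegrE ?mulr_ge0 ?hnorm_ge0 ?(ltW g0) //.
rewrite exprMn !(hnorm_sq Hip); nra.
Qed.

(* With [y_n = T (T - h_n)^-1 q] and [h_n -> 0], the vectors [y_n] lie in the
   range of [T], so [coercive_on_range] makes them Cauchy; their limit differs
   from [q] by an element of the kernel, orthogonal to [q] and to the range. *)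
Lemma coercive_on_ker_orthogonal g q : hcomplete ip -> 0 < g ->
  (forall h, 0 < h <= g / 2 ->
     surj_on D (shift T h) /\ coercive_on ip D h (shift T h)) ->
  coercive_on ip D (g / 2) (shift T (- (g / 2))) ->
  D q -> (forall x, D x -> T x = 0 -> rip ip x q = 0) ->
  g * hnorm ip q <= hnorm ip (T q).
Proof.
move=> cpl g0 ch cg dq qker.
have g20 : 0 < g / 2 by lra.
have g2le : 0 < g / 2 <= g / 2 by rewrite g20 lexx.
pose h n := invS (g / 2) n.
have h0 n : 0 < h n by rewrite /h /invS divr_gt0.
have hle n : h n <= g / 2 by rewrite /h /invS ler_pdivrMr // ler_peMr ?(ltW g20) // ler1n.
have hn n : 0 < h n <= g / 2 by rewrite h0 hle.
have [p hp] := choice (fun n => (ch _ (hn n)).1 q).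
have dp n : D (p n) by case: (hp n).
pose k n := (h n)%:C%C *: p n.
have dk n : D (k n) by apply: subspaceZ.
pose y n := T (p n).
have yE n : y n = q + k n by case: (hp n) => _ <-; rewrite /shift subrK.
have dy n : D (y n) by rewrite yE; apply: subspaceD.
have nk n : hnorm ip (k n) <= hnorm ip q.
  have := (ch _ (hn n)).2 _ (dp n); rewrite (hp n).2.
  by rewrite (hnormZ Hip) gtr0_norm.
have ny n : hnorm ip (y n) <= 2 * hnorm ip q.
  have := hnormD Hip q (k n); rewrite -yE; have := nk n; lra.
have Tk n : T (k n) = (h n)%:C%C *: y n by rewrite (linear_onZ sD lT).
have Ty n : T (y n) = T q + (h n)%:C%C *: y n.
  by rewrite {1}yE (linear_onD lT) // Tk.
have rng x : D x -> D (T x) -> g * hnorm ip (T x) <= hnorm ip (T (T x)).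
  by apply: coercive_on_range => //; exact: (ch _ g2le).2.
have Q0 := hnorm_ge0 (ip := ip) q.
pose C := 2 * hnorm ip q.
have C0 : 0 <= C by rewrite /C; lra.
have hhy n : hnorm ip ((h n)%:C%C *: y n) <= h n * C.
  by rewrite (hnormZ Hip) gtr0_norm // ler_wpM2l // ltW.
have [n m nm|l hl] := hcomplete_rate Hip y C cpl C0.
  have yB : y m - y n = T (p m - p n) by rewrite (linear_onB sD lT).
  have dB : D (T (p m - p n)) by rewrite -yB; apply: subspaceB.
  have := rng (p m - p n) (subspaceB sD (dp m) (dp n)) dB.
  rewrite -yB (linear_onB sD lT) // !Ty opprD addrACA subrr add0r => h1.
  have := hnormB Hip ((h m)%:C%C *: y m) ((h n)%:C%C *: y n).
  have := hhy n; have := hhy m.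
  have : h m * C <= h n * C.
    by rewrite ler_wpM2r // /h invS_anti // ltW.
  have -> : invS C n = 2 * (h n * C) / g.
    by rewrite /h /invS; field; rewrite (gt_eqF g0) nat1r pnatr_eq0.
  rewrite ler_pdivlMr // mulrC; lra.
pose l0 := l - q.
have kl n : k n - l0 = y n - l by rewrite yE /l0 opprB addrCA addrA.
have [k' [dk' k'E]] := (ch _ g2le).1 (- ((g / 2)%:C%C *: l0)).
have hC n : h n * C = g / 2 * invS C n by rewrite /h /invS; ring.
have kk' n : hnorm ip (k n - k') <= 2 * invS C n.
  have := (ch _ g2le).2 _ (subspaceB sD (dk n) dk').
  have -> : shift T (g / 2) (k n - k') =
      (h n)%:C%C *: y n - (g / 2)%:C%C *: (k n - l0).
    rewrite (linear_onB sD (shift_linear_on _ lT)) // k'E /shift Tk.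
    by rewrite opprK [_ *: (k n - l0)]scalerBr [- (_ - _)]opprB addrA addrAC.
  have := hnormB Hip ((h n)%:C%C *: y n) ((g / 2)%:C%C *: (k n - l0)).
  rewrite (hnormZ Hip _ (k n - l0)) gtr0_norm // kl.
  have := hhy n; rewrite hC; have := hl n => h1 h2 h3 h4.
  rewrite -(ler_pM2l g20).
  have : g / 2 * hnorm ip (y n - l) <= g / 2 * invS C n by rewrite ler_pM2l.
  lra.
have l0E : l0 = k'.
  apply/eqP; rewrite -subr_eq0; apply/eqP/(hnorm_eq0 Hip)/le_anti.
  rewrite hnorm_ge0 andbT; apply: (le0_invS _ (3 * C)); first lra.
  move=> n; have := hnormB Hip (k n - k') (k n - l0).
  have -> : invS (3 * C) n = 2 * invS C n + invS C n by rewrite /invS; ring.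
  rewrite [- (_ - _)]opprB addrC addrA subrK kl; have := kk' n; have := hl n; lra.
have Tl0 : T l0 = 0.
  by move: k'E; rewrite -l0E /shift => /(canRL (subrK _)); rewrite addNr.
have dl0 : D l0 by rewrite l0E.
have orth n : rip ip l0 (k n) = 0.
  have : rip ip l0 (y n) = 0 by rewrite /y -sT // Tl0 /rip (ip0l Hip).
  by rewrite yE (ripDr Hip) qker // add0r.
have l00 : l = q.
  apply/eqP; rewrite -subr_eq0; apply/eqP/(hnorm_eq0 Hip)/le_anti.
  rewrite hnorm_ge0 andbT; apply: (le0_invS _ C) => // n.
  have := rip_cauchy_schwarz Hip l0 (l0 - k n).
  rewrite (ripDr Hip) (ripNr Hip) orth subr0 -(hnorm_sq Hip) -/l0.
  rewrite (hnormBC Hip l0) kl; have := hl n => h1 h2.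
  have [->|z] := eqVneq (hnorm ip l0) 0; first exact: invS_ge0.
  have zp : 0 < hnorm ip l0 by rewrite lt_neqAle eq_sym z hnorm_ge0.
  apply: le_trans h1; rewrite -(ler_pM2l zp) -expr2 //.
rewrite -subr_le0; apply: (le0_invS _ ((g + g / 2) * C)).
  by rewrite mulr_ge0 //; lra.
move=> n; have := rng (p n) (dp n) (dy n); rewrite -/(y n) Ty.
have := hnormD Hip (T q) ((h n)%:C%C *: y n); have := hhy n.
have -> : invS ((g + g / 2) * C) n = g * invS C n + h n * C.
  by rewrite /h /invS; ring.
have := hnormB_ge Hip q (y n); rewrite (hnormBC Hip q) -{2}l00 => h1 h2 h3 h4.
have : g * (hnorm ip q - hnorm ip (y n)) <= g * invS C n.
  by rewrite ler_pM2l //; apply: le_trans h1 (hl n).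
lra.
Qed.

End Gap.

Section BoundedPerturbation.
Context {R : realType} {V : lmodType R[i]} {ip : V -> V -> R[i]}.
Context {D : V -> Prop}.
Hypotheses (Hip : is_inner_product ip) (cpl : hcomplete ip) (sD : subspace D).
Implicit Types (T B : V -> V) (x y u : V) (z : R[i]).

Lemma subspace_setT : subspace (fun _ : V => True).
Proof. by []. Qed.

Lemma opnorm_bound B : bounded_op ip B ->
  0 <= opnorm ip B /\ forall x, hnorm ip (B x) <= opnorm ip B * hnorm ip x.
Proof.
move=> [lB [M hM]].
have B0 : B 0 = 0 by apply: (linear_on0 subspace_setT lB).
set S := [set hnorm ip (B x) | x in [set x | hnorm ip x <= 1]].
have S0 : S 0 by exists 0; rewrite /= ?B0 (hnorm0 Hip).
have hS : has_sup S.
  split; first by exists 0.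
  exists `|M| => _ [x /= x1 <-]; apply: le_trans (hM x) _.
  apply: le_trans (ler_norm _) _; rewrite normrM (ger0_norm (hnorm_ge0 x)).
  by rewrite ler_piMr.
split=> [|x]; first exact: (sup_upper_bound hS).
have [/(hnorm_eq0 Hip) ->|x0] := eqVneq (hnorm ip x) 0.
  by rewrite B0 (hnorm0 Hip) mulr0.
have xp : 0 < hnorm ip x by rewrite lt_neqAle eq_sym x0 hnorm_ge0.
rewrite -ler_pdivrMr //; apply: (sup_upper_bound hS).
exists ((hnorm ip x)^-1%:C%C *: x) => /=.
  by rewrite (hnormZ Hip) ger0_norm ?invr_ge0 ?hnorm_ge0 // mulVf.
rewrite (linear_onZ subspace_setT lB) // (hnormZ Hip) mulrC.
by rewrite ger0_norm // invr_ge0 hnorm_ge0.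
Qed.

Lemma resolvent_coercive T z : resolvent ip D T z ->
  surj_on D (fun x => T x - z *: x) /\
  exists2 k, 0 < k & coercive_on ip D k (fun x => T x - z *: x).
Proof.
move=> [sur [M hM]]; split=> //.
have M0 : 0 < `|M| + 1 by rewrite ltr_wpDl.
exists (`|M| + 1)^-1; first by rewrite invr_gt0.
move=> x dx; rewrite mulrC ler_pdivrMr //; apply: le_trans (hM x dx) _.
rewrite mulrC ler_wpM2l ?hnorm_ge0 //.
by apply: le_trans (ler_norm M) _; rewrite lerDl.
Qed.

Lemma coercive_resolvent T z k : 0 < k ->
  surj_on D (fun x => T x - z *: x) ->
  coercive_on ip D k (fun x => T x - z *: x) -> resolvent ip D T z.
Proof.
move=> k0 sur ck; split=> //; exists k^-1 => x dx.
by rewrite mulrC ler_pdivlMr // mulrC; apply: ck.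
Qed.

(* Picard iteration for [x = T^-1 (y - B x)]. *)
Lemma surj_on_perturb T B k c : linear_on D T -> linear_on setT B ->
  (forall x, hnorm ip (B x) <= c * hnorm ip x) ->
  0 < k -> c <= k / 2 -> surj_on D T -> coercive_on ip D k T ->
  surj_on D (fun x => T x + B x).
Proof.
move=> lT lB hB k0 ck sur cT y.
have [S hS] := choice (fun y => sur y).
have SD v : D (S v) by case: (hS v).
have TS v : T (S v) = v by case: (hS v).
have BB u v : B (u - v) = B u - B v.
  by apply: (linear_onB subspace_setT lB).
have contr u v : hnorm ip (S (y - B u) - S (y - B v)) <= hnorm ip (u - v) / 2.
  have := cT _ (subspaceB sD (SD (y - B u)) (SD (y - B v))).
  have E : y - B u - (y - B v) = B (v - u) by rewrite BB opprB addrC addrA subrK.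
  rewrite (linear_onB sD lT) // !TS E => h1.
  have := hB (v - u); rewrite (hnormBC Hip v) => h2.
  have h3 : c * hnorm ip (u - v) <= k / 2 * hnorm ip (u - v).
    by rewrite ler_wpM2r ?hnorm_ge0.
  rewrite -(ler_pM2l k0); lra.
pose u n := iter n (fun v => S (y - B v)) 0.
pose C := 2 * hnorm ip (u 1%N).
have C0 : 0 <= C by rewrite mulr_ge0 ?hnorm_ge0.
have pow_le n : (2^-1 : R) ^+ n <= n.+1%:R^-1.
  rewrite exprVn lef_pV2 ?posrE ?exprn_gt0 ?ltr0Sn // -natrX ler_nat.
  exact: ltn_expl.
have d1 n : hnorm ip (u n.+1 - u n) <= 2^-1 ^+ n * hnorm ip (u 1%N).
  elim: n => [|n IH]; first by rewrite subr0 expr0 mul1r.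
  apply: le_trans (contr _ _) _; rewrite exprS; move: IH; lra.
have d2 n m : hnorm ip (u (n + m)%N - u n) <= 2^-1 ^+ n * C * (1 - 2^-1 ^+ m).
  elim: m => [|m IH]; first by rewrite addn0 subrr (hnorm0 Hip) expr0; lra.
  have := hnormD Hip (u (n + m.+1)%N - u (n + m)%N) (u (n + m)%N - u n).
  rewrite addrA subrK addnS; have := d1 (n + m)%N.
  rewrite exprS exprD /C; move: IH; rewrite /C; lra.
have [n m nm|l hl] := hcomplete_rate Hip u C cpl C0.
  rewrite -(subnKC nm); apply: le_trans (d2 _ _) _.
  have p0 : 0 <= (2^-1 : R) ^+ (m - n) by rewrite exprn_ge0 // invr_ge0.
  have q0 : 0 <= (2^-1 : R) ^+ n by rewrite exprn_ge0 // invr_ge0.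
  apply: (@le_trans _ _ (2^-1 ^+ n * C)).
    have : 0 <= 2^-1 ^+ n * C * 2^-1 ^+ (m - n) by apply: mulr_ge0 => //; apply: mulr_ge0.
    lra.
  by rewrite /invS mulrC ler_wpM2l.
have lE : l = S (y - B l).
  apply/eqP; rewrite -subr_eq0; apply/eqP/(hnorm_eq0 Hip)/le_anti.
  rewrite hnorm_ge0 andbT; apply: (le0_invS _ (2 * C)); first lra.
  move=> n; have := contr (u n) l; rewrite -[S (y - B (u n))]/(u n.+1) => h1.
  have h2 := hl n; have h3 := hl n.+1.
  have h4 := invS_anti C n.+1 n C0 (leqnSn n).
  have := hnormB Hip (u n.+1 - S (y - B l)) (u n.+1 - l).
  rewrite opprB addrC addrA subrK.
  have -> : invS (2 * C) n = invS C n + invS C n by rewrite /invS; ring.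
  have := hnorm_ge0 (ip := ip) (u n - l); lra.
by exists l; split; [rewrite lE | rewrite {1}lE TS subrK].
Qed.

Lemma surj_on_continuation T B k b (eps : R) : linear_on D T -> linear_on setT B ->
  (forall x, hnorm ip (B x) <= b * hnorm ip x) -> 0 < k ->
  surj_on D T ->
  (forall s, `|s| <= `|eps| -> coercive_on ip D k (fun x => T x + s%:C%C *: B x)) ->
  surj_on D (fun x => T x + eps%:C%C *: B x).
Proof.
move=> lT lB hB k0 sur ck.
have C0 : 0 <= `|eps| * `|b| by rewrite mulr_ge0.
have k20 : 0 < k / 2 by lra.
have [n hn] := invS_lt (`|eps| * `|b|) (k / 2) C0 k20.
pose s m := eps * (m%:R / n.+1%:R) : R.
have sle m : (m <= n.+1)%N -> `|s m| <= `|eps|.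
  move=> mn; rewrite /s normrM ler_piMr // ger0_norm ?divr_ge0 //.
  by rewrite ler_pdivrMr ?ltr0Sn // mul1r ler_nat.
suff H m : (m <= n.+1)%N -> surj_on D (fun x => T x + (s m)%:C%C *: B x).
  have := H n.+1 (leqnn _); rewrite /s divff ?mulr1 //.
  by rewrite pnatr_eq0.
elim: m => [_ y|m IH mn y].
  have [x [dx Tx]] := sur y; exists x; split=> //.
  by rewrite /s mul0r mulr0 scale0r addr0.
have linT : linear_on D (fun x => T x + (s m)%:C%C *: B x).
  move=> a u v du dv; rewrite lT // lB // scalerDr scalerDr addrACA.
  by congr (_ + _ + _); rewrite !scalerA mulrC.
pose d := eps / n.+1%:R.
have linB : linear_on setT (fun x => d%:C%C *: B x).
  by move=> a u v _ _; rewrite lB // scalerDr !scalerA mulrC.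
have boundB x : hnorm ip (d%:C%C *: B x) <= (`|d| * `|b|) * hnorm ip x.
  rewrite (hnormZ Hip) -mulrA ler_wpM2l //; apply: le_trans (hB x) _.
  by rewrite ler_wpM2r ?hnorm_ge0 // ler_norm.
have small : `|d| * `|b| <= k / 2.
  apply: ltW; move: hn; rewrite /invS /d normrM.
  by rewrite (@ger0_norm _ n.+1%:R^-1) ?invr_ge0 // mulrAC.
have [||x [dx hx]] := surj_on_perturb _ _ k _ linT linB boundB k0 small _ _ y.
- by apply: IH; apply: ltnW.
- by apply: ck; apply: sle; apply: ltnW.
exists x; split=> //; rewrite -hx -addrA -scalerDl -(rmorphD (real_complex _)).
congr (_ + (_ %:C)%C *: _); rewrite /s /d -addn1 natrD; ring.
Qed.

End BoundedPerturbation.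

(* [P] and [Q] are the squared norms of the components of an approximate
   eigenvector along the nearest eigenvector, at distance [t], and along its
   complement, at distance at least [2 delta - t]. *)
Lemma spectral_mass_contradiction (R : realType) (delta a t P Q Y eta : R) :
  0 < delta -> 0 <= a < delta -> 0 <= t < delta -> 0 <= P -> 0 <= Q ->
  0 < P + Q -> 0 < Y -> 0 < eta ->
  eta <= (delta - a) / 2 -> eta <= Y * ((delta - a) / (4 * delta)) ->
  Y * (P - Q) <= eta * (P + Q) ->
  t ^+ 2 * P + (2 * delta - t) ^+ 2 * Q <= (a + eta) ^+ 2 * (P + Q) -> False.
Proof.
move=> d0 /andP[a0 ad] /andP[t0 td] P0 Q0 S0 Y0 e0 e1 e2 h1 h2.
pose s := (delta - a) / (4 * delta).
have s0 : 0 <= s by rewrite divr_ge0 //; lra.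
have ds : delta * s = (delta - a) / 4 by rewrite /s; field; rewrite gt_eqF.
have h3 : P - Q <= s * (P + Q).
  rewrite -(ler_pM2l Y0); apply: le_trans h1 _; rewrite mulrA.
  by rewrite ler_wpM2r // ltW.
have h4 : (a + eta) ^+ 2 <= ((a + delta) / 2) ^+ 2.
  by rewrite ler_pXn2r ?nnegrE //; lra.
have h5 : (a + eta) ^+ 2 * (P + Q) <= ((a + delta) / 2) ^+ 2 * (P + Q).
  by rewrite ler_wpM2r // ltW.
have h6 : 2 * delta * (delta - t) * (P - Q) <=
    2 * (delta - t) * ((delta - a) / 4) * (P + Q).
  have -> : 2 * (delta - t) * ((delta - a) / 4) * (P + Q) =
     2 * delta * (delta - t) * (s * (P + Q)) by rewrite -ds; ring.
  by rewrite ler_wpM2l // mulr_ge0 ?mulr_ge0; lra.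
have h7 : 0 <= ((delta - t) - (delta - a) / 4) ^+ 2 * (P + Q).
  by rewrite mulr_ge0 ?sqr_ge0 // ltW.
have h8 : 0 < (delta - a) ^+ 2 * (P + Q).
  by rewrite mulr_gt0 // exprn_gt0 // subr_gt0.
have h9 : 0 <= (delta - a) * a * (P + Q).
  by rewrite !mulr_ge0 //; lra.
lra.
Qed.

Section SimpleSpectrum.
Context {R : realType} {V : lmodType R[i]} {ip : V -> V -> R[i]}.
Context {D : V -> Prop} {H0 J : V -> V} {lam : nat -> R} {delta : R}.
Hypotheses (Hip : is_inner_product ip) (cpl : hcomplete ip).
Hypothesis saH0 : self_adjoint ip D H0.
Hypothesis specH0 : spectrum ip D H0 = [set (lam j)%:C%C | j in [set: nat]].
Hypothesis simpleH0 : forall j, simple_eigenvalue D H0 (lam j)%:C%C.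
Hypotheses (delta0 : 0 < delta).
Hypothesis lam_gap : forall j k, j != k -> 2 * delta <= `|lam j - lam k|.
Implicit Types (x u p q : V) (r w : R).

Let sD : subspace D. Proof. by case: saH0. Qed.
Let lH0 : linear_on D H0. Proof. by case: saH0. Qed.
Let sym : symmetric_on ip D H0.
Proof. by case: saH0 => _ _ _ _ s x y dx dy; rewrite /rip s. Qed.

Lemma not_eigenvalue_resolvent z :
  (forall j, z <> (lam j)%:C%C) -> resolvent ip D H0 z.
Proof.
move=> hz; apply: contrapT => h.
have : spectrum ip D H0 z by [].
by rewrite specH0 => -[j _ /esym]; apply: hz.
Qed.

Lemma shift_resolvent w : (forall j, w != lam j) ->
  surj_on D (shift H0 w) /\ exists2 k, 0 < k & coercive_on ip D k (shift H0 w).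
Proof.
move=> hw; apply: resolvent_coercive; apply: not_eigenvalue_resolvent => j.
by move=> [] /eqP; rewrite (negbTE (hw j)).
Qed.

Lemma coercive_dist_spectrum r w : 0 < r -> (forall j, r <= `|w - lam j|) ->
  coercive_on ip D r (shift H0 w).
Proof.
move=> r0 hr.
apply: (gap_coercive Hip sD (shift_linear_on _ lH0)
          (shift_symmetric_on Hip _ sym) _ (ltW r0)) => [|d dr].
  apply: (shift_resolvent w _).1 => j; apply/eqP => e.
  by have := hr j; rewrite e subrr normr0 leNgt r0.
have [j|_ [k k0 ck]] := shift_resolvent (w + d).
  apply/eqP => e; have := hr j; rewrite -e opprD addrA subrr add0r normrN.
  by rewrite leNgt dr.
by exists k => // x dx; rewrite shift_shift; apply: ck.
Qed.

Lemma coercive_eigenvector_orthogonal j q :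
  D q -> (forall x, D x -> shift H0 (lam j) x = 0 -> rip ip x q = 0) ->
  2 * delta * hnorm ip q <= hnorm ip (shift H0 (lam j) q).
Proof.
move=> dq qker.
have dist (s h : R) k : `|s| = 1 -> 0 < h <= delta -> h <= `|lam j + s * h - lam k|.
  move=> s1 /andP[h0 hd].
  have nsh : `|s * h| = h by rewrite normrM s1 mul1r gtr0_norm.
  have [<-|jk] := eqVneq j k; first by rewrite addrAC subrr add0r nsh.
  have := lerB_normD (lam j - lam k) (s * h).
  by rewrite nsh addrAC; have := lam_gap _ _ jk; lra.
have dd : 2 * delta / 2 = delta by field.
apply: (coercive_on_ker_orthogonal Hip sD (shift_linear_on _ lH0)
  (shift_symmetric_on Hip _ sym) (2 * delta)) => //; rewrite ?dd; first by rewrite mulr_gt0.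
  move=> h hh; have n1 := normr1 R.
  have hj k := dist 1 h k n1 hh; have /andP[h0 _] := hh.
  have nz k : lam j + h != lam k.
    apply/eqP => e; have := hj k; rewrite mul1r e subrr normr0 leNgt h0 //.
  split.
    by move=> y; have [x] := (shift_resolvent _ nz).1 y; rewrite -shift_shift; exists x.
  move=> x dx; rewrite shift_shift; apply: coercive_dist_spectrum => // k.
  by have := hj k; rewrite mul1r.
move=> x dx; rewrite shift_shift; apply: coercive_dist_spectrum => // k.
have := dist (- 1) delta k; rewrite mulN1r normrN normr1 => -> //.
by rewrite delta0 lexx.
Qed.

Hypothesis uJ : unitary_involution ip J.
Hypotheses (JD : forall x, D x -> D (J x)) (JH0 : forall x, D x -> J (H0 x) = H0 (J x)).

Lemma unitary_involution_adjoint x u : ip (J x) u = ip x (J u).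
Proof. by case: uJ => _ h JJ; rewrite -h JJ. Qed.

Lemma hnorm_unitary_involution x : hnorm ip (J x) = hnorm ip x.
Proof. by case: uJ => _ h _; rewrite /hnorm h. Qed.

Lemma eigenvector_decomposition j u : D u -> exists p q,
  [/\ u = p + q, D p, D q, H0 p = (lam j)%:C%C *: p & J p = p \/ J p = - p] /\
  ip p q = 0 /\ 2 * delta * hnorm ip q <= hnorm ip (shift H0 (lam j) q).
Proof.
move=> du; case: uJ => lJ isoJ JJ.
have [v [dv v0 Hv simple]] := simpleH0 j.
have vv0 : ip v v != 0 by apply/eqP => h; case: Hip => _ _ _ /(_ v h).
pose p := (ip u v / ip v v) *: v.
have dp : D p by apply: subspaceZ.
have dq : D (u - p) by apply: subspaceB.
have qv : ip (u - p) v = 0.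
  by rewrite (ipDl Hip) (ipNl Hip) (ipZl Hip) divfK // subrr.
have vq := ip_sym_eq0 Hip _ _ qv.
exists p, (u - p); split; [split=> // | split].
- by rewrite addrC subrK.
- by rewrite (linear_onZ sD lH0) // Hv !scalerA mulrC.
- have [c Jv] : exists c, J v = c *: v.
    apply: simple; first exact: JD.
    by rewrite -JH0 // Hv (linear_onZ subspace_setT lJ).
  have : (c * c - 1) *: v = 0.
    rewrite scalerBl scale1r -scalerA -Jv -(linear_onZ subspace_setT lJ) //.
    by rewrite -Jv JJ subrr.
  move/eqP; rewrite scaler_eq0 => /orP[|/eqP //].
  rewrite -expr2 subr_eq0 sqrf_eq1.
  rewrite /p !(linear_onZ subspace_setT lJ) // Jv => /orP[] /eqP ->.
    by left; rewrite scale1r.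
  by right; rewrite scaleN1r scalerN.
- by rewrite (ipZl Hip) vq mulr0.
- apply: coercive_eigenvector_orthogonal => // x dx /eqP.
  rewrite /shift subr_eq0 => /eqP /(simple _ dx) [b ->].
  by rewrite /rip (ipZl Hip) vq mulr0.
Qed.

(* [(x, y) |-> ip x (J y)] is an indefinite form for which [H0 + B] is
   symmetric, so approximate eigenvectors for a nonreal [z] are nearly neutral
   for it, while they concentrate on an eigenvector of [H0], where the form is
   definite. *)
Lemma coercive_nonreal (B : V -> V) (a : R) (z : R[i]) (eta : R) :
  0 <= a < delta -> (forall x, hnorm ip (B x) <= a * hnorm ip x) ->
  (forall x, complex.Im (ip (B x) (J x)) = 0) ->
  complex.Im z != 0 -> 0 < eta -> eta <= (delta - a) / 2 ->
  eta <= `|complex.Im z| * ((delta - a) / (4 * delta)) ->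
  coercive_on ip D eta (fun x => H0 x + B x - z *: x).
Proof.
move=> ha hB BJ z0 eta0 e1 e2 u du; have /andP[a0 ad] := ha.
case: (uJ) => lJ isoJ JJ.
set v := H0 u + B u - z *: u; rewrite leNgt; apply/negP => hv.
have un0 : 0 < hnorm ip u by rewrite -(pmulr_rgt0 _ eta0) (le_lt_trans _ hv) ?hnorm_ge0.
have uJreal : complex.Im (ip u (J u)) = 0.
  have : ip u (J u) = conjc (ip u (J u)).
    by rewrite -(ipC Hip) unitary_involution_adjoint.
  by case: (ip u (J u)) => ? c [] /= h; lra.
have H0Jreal : complex.Im (ip (H0 u) (J u)) = 0.
  have : ip (H0 u) (J u) = conjc (ip (H0 u) (J u)).
    rewrite -(ipC Hip) unitary_involution_adjoint JH0 //.
    by case: saH0 => _ _ _ _ -> //; apply: JD.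
  by case: (ip (H0 u) (J u)) => ? c [] /= h; lra.
have neutral : `|complex.Im z| * `|rip ip u (J u)| <= eta * rip ip u u.
  have := Im_cauchy_schwarz Hip v (J u); rewrite hnorm_unitary_involution.
  have -> : complex.Im (ip v (J u)) = - (complex.Im z * rip ip u (J u)).
    rewrite /v !(ipDl Hip) (ipNl Hip) (ipZl Hip) /rip.
    have ImE (c1 c2 c3 c4 : R[i]) : complex.Im c1 = 0 -> complex.Im c2 = 0 ->
        complex.Im c3 = 0 ->
        complex.Im (c1 + c2 - c4 * c3) = - (complex.Im c4 * complex.Re c3).
      by case: c1 c2 c3 c4 => [? ?] [? ?] [? ?] [? ?] /= -> -> ->; ring.
    by rewrite ImE.
  rewrite normrN normrM => h; apply: le_trans h _.
  by rewrite -(hnorm_sq Hip) expr2 mulrA ler_wpM2r ?hnorm_ge0 // ltW.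
set w := shift H0 (complex.Re z) u.
have hw : hnorm ip w <= (a + eta) * hnorm ip u.
  pose c := z - (complex.Re z)%:C%C.
  have vE : v - B u = w - c *: u.
    by rewrite /v /w /shift /c scalerBl opprB addrA subrK addrAC addrK.
  have : hnorm ip w <= hnorm ip (w - c *: u).
    apply: (ler_hnorm Hip); rewrite ?hnorm_ge0 // (hnorm_sq Hip).
    have : rip ip w (c *: u) = 0.
      have wu : complex.Im (ip w u) = 0.
        have : ip w u = conjc (ip w u).
          rewrite -(ipC Hip) /w /shift (ipDl Hip) (ipDr Hip) (ipNl Hip) (ipNr Hip).
          rewrite (ipZl Hip) (ipZr Hip) conjc_real.
          by case: saH0 => _ _ _ _ ->.
        by case: (ip w u) => ? d [] /= h; lra.
      have ReE (c1 c2 : R[i]) : complex.Im c2 = 0 ->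
          complex.Re (conjc (c1 - (complex.Re c1)%:C%C) * c2) = 0.
        by case: c1 c2 => [? ?] [? ?] /= ->; ring.
      by rewrite /rip (ipZr Hip) ReE.
    move=> wcu; rewrite (rip_pythagoras Hip) ?lerDl ?rip_ge0 //.
    by rewrite (ripNr Hip) wcu oppr0.
  rewrite -vE => h; have := hnormB Hip v (B u); have := hB u; lra.
have wu : hnorm ip w ^+ 2 <= (a + eta) ^+ 2 * rip ip u u.
  by rewrite -(hnorm_sq Hip) -exprMn ler_pXn2r ?nnegrE ?mulr_ge0 ?hnorm_ge0 //; lra.
have [[j jd]|noj] := pselect (exists j, `|complex.Re z - lam j| < delta); last first.
  have far j : delta <= `|complex.Re z - lam j|.
    by rewrite leNgt; apply/negP => h; apply: noj; exists j.
  have h1 := @coercive_dist_spectrum delta (complex.Re z) delta0 far _ du.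
  by have := le_trans h1 hw; rewrite ler_pM2r //; lra.
have [p [q [[uE dp dq Hp Jp] [pq hq]]]] := eigenvector_decomposition j u du.
set t := `|complex.Re z - lam j| in jd.
have qp := ip_sym_eq0 Hip _ _ pq.
have rpq : rip ip p q = 0 by rewrite /rip pq.
have rqp : rip ip q p = 0 by rewrite /rip qp.
have uu : rip ip u u = rip ip p p + rip ip q q.
  by rewrite uE (rip_pythagoras Hip).
set wq := shift H0 (complex.Re z) q.
have wE : w = (lam j - complex.Re z)%:C%C *: p + wq.
  rewrite /w uE (linear_onD (shift_linear_on _ lH0)) // {1}/shift Hp.
  by rewrite (rmorphB (real_complex _)) scalerBl.
have rpw : rip ip p wq = 0.
  rewrite /wq -(shift_symmetric_on Hip _ sym) // /shift Hp !(ripE Hip) rpq; ring.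
have ww : rip ip w w = t ^+ 2 * rip ip p p + rip ip wq wq.
  rewrite wE (rip_pythagoras Hip) ?(ripZl Hip) ?rpw ?mulr0 // (ripZr Hip).
  rewrite /t real_normK ?num_real //; ring.
have hwq : (2 * delta - t) * hnorm ip q <= hnorm ip wq.
  have : shift H0 (lam j) q = wq + (complex.Re z - lam j)%:C%C *: q.
    by rewrite /wq /shift (rmorphB (real_complex _)) scalerBl addrA subrK.
  move: hq => /[swap] -> hq.
  have := hnormD Hip wq ((complex.Re z - lam j)%:C%C *: q).
  rewrite (hnormZ Hip) -/t; lra.
have t0 : 0 <= t by exact: normr_ge0.
have P0 := rip_ge0 Hip p; have Q0 := rip_ge0 Hip q.
have hQ : (2 * delta - t) ^+ 2 * rip ip q q <= rip ip wq wq.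
  rewrite -!(hnorm_sq Hip) -exprMn ler_pXn2r ?nnegrE ?hnorm_ge0 //.
  by rewrite mulr_ge0 ?hnorm_ge0 //; lra.
have form : rip ip p p - rip ip q q <= `|rip ip u (J u)|.
  have Ju : J u = J p + J q by rewrite uE (linear_onD lJ).
  have qJq : `|rip ip q (J q)| <= rip ip q q.
    rewrite -(hnorm_sq Hip) expr2 -{2}(hnorm_unitary_involution q) ler_norml.
    have := rip_cauchy_schwarz Hip (- q) (J q).
    by rewrite (ripNl Hip) (hnormN Hip) lerNl => ->; apply: rip_cauchy_schwarz.
  have pJq : rip ip p (J q) = 0.
    rewrite /rip -unitary_involution_adjoint -/(rip ip _ _).
    by case: Jp => ->; rewrite ?(ripNl Hip) rpq ?oppr0.
  rewrite Ju uE !(ripDl Hip, ripDr Hip) pJq.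
  move: qJq; rewrite ler_norml => /andP[b1 b2].
  case: Jp => ->; rewrite ?(ripNr Hip) rqp.
    by apply: le_trans (ler_norm _); lra.
  by rewrite -normrN; apply: le_trans (ler_norm _); lra.
apply: (@spectral_mass_contradiction R delta a t (rip ip p p) (rip ip q q)
  `|complex.Im z| eta) => //.
- by rewrite t0.
- by rewrite -uu -(hnorm_sq Hip) exprn_gt0.
- by rewrite normr_gt0.
- rewrite -uu; apply: le_trans neutral; exact: ler_wpM2l.
- rewrite -uu; apply: le_trans wu; rewrite (hnorm_sq Hip) ww; lra.
Qed.

End SimpleSpectrum.

Theorem theorem1p2 (R : realType) (V : lmodType R[i]) (ip : V -> V -> R[i])
  (D : V -> Prop) (H0 H1 H1adj J : V -> V) (lam : nat -> R) :
  is_inner_product ip -> hcomplete ip ->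
  self_adjoint ip D H0 -> bounded_below ip D H0 ->
  bounded_op ip H1 -> (exists x, H1 x <> 0) -> is_adjoint ip H1 H1adj ->
  unitary_involution ip J ->
  (forall x, D x -> D (J x)) ->
  (forall x, D x -> J (H0 x) = H0 (J x)) ->
  (forall x, J (H1 x) = H1adj (J x)) ->
  (forall j, lam j < lam j.+1) ->
  spectrum ip D H0 = [set (lam j)%:C%C | j in [set: nat]] ->
  (forall j, simple_eigenvalue D H0 (lam j)%:C%C) ->
  let delta := inf [set (lam j.+1 - lam j) / 2 | j in [set: nat]] in
  0 < delta ->
  forall eps : R, `|eps| < delta / opnorm ip H1 ->
    spectrum ip D (fun x => H0 x + eps%:C%C *: H1 x) `<=` [set z | complex.Im z = 0].
Proof.
move=> Hip cpl saH0 _ bH1 _ adj uJ JD JH0 JH1 lamS spec simple delta delta0 eps.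
have [b0 hb] := opnorm_bound Hip _ bH1; set b := opnorm ip H1 in b0 hb *.
have sD : subspace D by case: saH0.
have lH0 : linear_on D H0 by case: saH0.
have lH1 : linear_on setT H1 by case: bH1.
move=> heps z hz; apply: contrapT => /eqP z0; apply: hz => /=.
have ab : `|eps| * b < delta.
  have [b_eq|bn] := eqVneq b 0; first by rewrite b_eq mulr0.
  by rewrite -ltr_pdivlMr // lt_neqAle eq_sym bn.
have step j : 2 * delta <= lam j.+1 - lam j.
  have : delta <= (lam j.+1 - lam j) / 2.
    apply: ge_inf; last by exists j.
    by exists 0 => _ [k _ <-]; have := lamS k; lra.
  lra.
have gap j k : (j < k)%N -> 2 * delta <= lam k - lam j.
  elim: k => // k IH; rewrite ltnS leq_eqVlt => /orP[/eqP <-|/IH h] //.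
  by have := lamS k; lra.
have lam_gap j k : j != k -> 2 * delta <= `|lam j - lam k|.
  rewrite neq_ltn => /orP[] /gap h; last exact: le_trans h (ler_norm _).
  by rewrite distrC; apply: le_trans h (ler_norm _).
pose a := `|eps| * b.
have a0 : 0 <= a by apply: mulr_ge0.
pose eta := Num.min ((delta - a) / 2) (`|complex.Im z| * ((delta - a) / (4 * delta))).
have eta0 : 0 < eta.
  rewrite lt_min !mulr_gt0 ?invr_gt0 ?normr_gt0 ?mulr_gt0 ?subr_gt0 //.
have coer s : `|s| <= `|eps| ->
    coercive_on ip D eta (fun x => (H0 x - z *: x) + s%:C%C *: H1 x).
  move=> hs x dx; rewrite addrAC.
  apply: (coercive_nonreal Hip cpl saH0 spec simple delta0 lam_gap uJ JD JH0
    (fun x => s%:C%C *: H1 x) a z eta) => //.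
  - by rewrite a0.
  - move=> y; rewrite (hnormZ Hip) /a -mulrA; apply: ler_pM => //.
    exact: hnorm_ge0.
  - move=> y; rewrite (ipZl Hip).
    have : ip (H1 y) (J y) = conjc (ip (H1 y) (J y)).
      rewrite -(ipC Hip) (unitary_involution_adjoint uJ) JH1.
      exact: adj.
    case: (ip (H1 y) (J y)) => d c [] /= h; have -> : c = 0 by lra.
    by rewrite mulr0 mul0r addr0.
  - by rewrite ge_min lexx.
  - by rewrite ge_min lexx orbT.
have linz : linear_on D (fun x => H0 x - z *: x).
  move=> c x y dx dy; rewrite lH0 // scalerBr scalerDr opprD addrACA.
  by congr (_ - _ + _); rewrite !scalerA mulrC.
apply: (coercive_resolvent _ _ eta eta0) => [y|x dx].
  have [|x [dx hx]] := surj_on_continuation Hip cpl sD _ _ eta b eps linz lH1 hb eta0 _ coer y.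
    apply: (resolvent_coercive _ _ _).1; apply: (not_eigenvalue_resolvent spec) => j e.
    by move: z0; rewrite e eqxx.
  by exists x; split=> //; rewrite addrAC.
by have := coer eps (lexx _) x dx; rewrite addrAC.
Qed.
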